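(* Let $C=(C_\bullet,b,B)$ and $\bar C=(\bar C_\bullet,b,B)$ be parachain complexes of $k$-modules. Let $f:C_\bullet\to\bar C_\bullet$ and $g:\bar C_\bullet\to C_\bullet$ be $k$-linear maps commuting with $b$, and $\varphi:C_\bullet\to C_{\bullet+1}$ a $k$-linear map, such that $fg=1$ and $gf=1+b\varphi+\varphi b$. Suppose that $f$ is a map of parachain complexes (i.e. it also commutes with $B$), that $g$ and $\varphi$ are $T$-compatible (commute with the $T$-operators), and that $\varphi$ is special ($f\varphi=0$, $\varphi g=0$, $\varphi^2=0$). Let $g^\natural,\varphi^\natural$ be as defined in the context. Then: (i) $g^\natural:\bar C^\natural_\bullet\to C^\natural_\bullet$ is an $S$-map and a co-extension of $g$. (ii) $fg^\natural=1$ and $g^\natural f=1+(b+Bu^{-1})\varphi^\natural+\varphi^\natural(b+Bu^{-1})$. In particular, this provides an $S$-deformation retract of $C^\natural$ to $\bar C^\natural$ and a $T$-deformation retract of $C^\sharp$ to $\bar C^\sharp$. (iii) The chain homotopy $\varphi^\natural$ is special, i.e. $f\varphi^\natural=0$, $\varphi^\natural g^\natural=0$, $(\varphi^\natural)^2=0$.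
   Context: $k$ is a unital ring, not assumed commutative; $k$-modules are left modules. A parachain complex $(C_\bullet,b,B)$ consists of $k$-modules $C_m$ ($m\ge0$) and $k$-linear maps $b:C_\bullet\to C_{\bullet-1}$, $B:C_\bullet\to C_{\bullet+1}$ with $b^2=0$, $B^2=0$, such that $T:=1-(bB+Bb)$ is an isomorphism. Put $C^\natural_m=\bigoplus_{p\ge0,\,2p\le m}C_{m-2p}u^p$, $u$ a formal variable; $u^{-1}(xu^p)=xu^{p-1}$ for $p\ge1$, $u^{-1}(xu^0)=0$; other operators (including $f$) act on coefficients. $C^\natural=(C^\natural_\bullet,d,S,T)$ with $d=b+Bu^{-1}$ and $S=u^{-1}$ is a para-$S$-module: $d^2=S(1-T)$ and $d,S,T$ commute pairwise. An $S$-map is a degree $0$ $k$-linear map commuting with $d,S,T$. A co-extension of a $T$-compatible map $g:\bar C_\bullet\to C_\bullet$ commuting with $b$ is an $S$-map $\bar C^\natural_\bullet\to C^\natural_\bullet$ of the form $g^{(0)}+g^{(1)}u^{-1}+\cdots$ with $g^{(j)}:\bar C_\bullet\to C_{\bullet+2j}$ and $g^{(0)}=g$. An $S$-deformation retract of $C^\natural$ to $\bar C^\natural$ is given by $S$-maps $F:C^\natural_\bullet\to\bar C^\natural_\bullet$, $G:\bar C^\natural_\bullet\to C^\natural_\bullet$ with $FG=1$ and $GF=1+dH+Hd$ for a $k$-linear $H$ of degree $+1$ commuting with $S$ and $T$. The periodic para-complex is $C^\sharp=(C_0^\sharp\oplus C_1^\sharp,b+B,T)$ with $C_i^\sharp=\prod_{q\ge0}C_{2q+i}$,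 $i=0,1$. A $T$-deformation retract of periodic para-complexes is a deformation retract (for the odd operators $b+B$) whose maps and homotopy commute with $T$. Definitions: $\varphi^\natural=\sum_{j\ge0}\varphi(B\varphi)^ju^{-j}:C^\natural_\bullet\to C^\natural_{\bullet+1}$; $g^\natural=g+\sum_{j\ge1}(\varphi B)^jg\,u^{-j}$. *)

(* Defs.v *)
From HB Require Import structures.
From mathcomp Require Import all_boot all_algebra zify.
From mathcomp Require Import boolp.

Set Implicit Arguments.
Unset Strict Implicit.
Unset Printing Implicit Defensive.

Import GRing.Theory.
Local Open Scope ring_scope.

(* Product of an arbitrary family of left modules (MathComp only provides the
   module structure on functions into a single module). *)
Definition dprod (I : Type) (V : I -> Type) : Type := forall i, V i.

HB.instance Definition _ (I : Type) (V : I -> choiceType) :=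
  Choice.copy (dprod V) (forall i, V i).

Section DprodZmod.
Variables (I : Type) (V : I -> zmodType).
Implicit Types x y z : dprod V.

Let add x y : dprod V := fun i => x i + y i.
Let opp x : dprod V := fun i => - x i.
Let zero : dprod V := fun i => 0.

Fact dprod_addA : associative add.
Proof. by move=> x y z; apply: functional_extensionality_dep => i; apply: addrA. Qed.
Fact dprod_addC : commutative add.
Proof. by move=> x y; apply: functional_extensionality_dep => i; apply: addrC. Qed.
Fact dprod_add0 : left_id zero add.
Proof. by move=> x; apply: functional_extensionality_dep => i; apply: add0r. Qed.
Fact dprod_addN : left_inverse zero opp add.
Proof. by move=> x; apply: functional_extensionality_dep => i; apply: addNr. Qed.

HB.instance Definition _ := GRing.isZmodule.Build (dprod V)
  dprod_addA dprod_addC dprod_add0 dprod_addN.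
End DprodZmod.

Section DprodLmod.
Variables (k : pzRingType) (I : Type) (V : I -> lmodType k).
Implicit Types x y z : dprod V.

Let scale (a : k) x : dprod V := fun i => a *: x i.

Fact dprod_scaleA a b x : scale a (scale b x) = scale (a * b) x.
Proof. by apply: functional_extensionality_dep => i; apply: scalerA. Qed.
Fact dprod_scale1 : left_id 1 scale.
Proof. by move=> x; apply: functional_extensionality_dep => i; apply: scale1r. Qed.
Fact dprod_scaleDr : right_distributive scale +%R.
Proof. by move=> a x y; apply: functional_extensionality_dep => i; apply: scalerDr. Qed.
Fact dprod_scaleDl x : {morph scale^~ x : a b / a + b}.
Proof. by move=> a b; apply: functional_extensionality_dep => i; apply: scalerDl. Qed.

HB.instance Definition _ := GRing.Zmodule_isLmodule.Build k (dprod V)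
  dprod_scaleA dprod_scale1 dprod_scaleDr dprod_scaleDl.
End DprodLmod.

Section Graded.
Variable k : pzRingType.

(* A graded module is a family indexed by nat, understood to be 0 in negative
   degrees.  [anticomm lo up] is lo up + up lo; in degree 0 the second term
   factors through degree -1. *)
Definition anticomm (V : nat -> lmodType k) (lo : forall m, V m.+1 -> V m)
    (up : forall m, V m -> V m.+1) m : V m -> V m :=
  match m with
  | 0 => fun x => lo 0%N (up 0%N x)
  | m'.+1 => fun x => lo m'.+1 (up m'.+1 x) + up m' (lo m' x)
  end.

Definition special (V W : nat -> lmodType k) (f : forall m, V m -> W m)
    (g : forall m, W m -> V m) (h : forall m, V m -> V m.+1) : Prop :=
  [/\ forall m x, f m.+1 (h m x) = 0,
      forall m y, h m (g m y) = 0
    & forall m x, h m.+1 (h m x) = 0].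

Record parachain := Parachain {
  pc_obj :> nat -> lmodType k;
  pc_b : forall m, {linear pc_obj m.+1 -> pc_obj m};
  pc_B : forall m, {linear pc_obj m -> pc_obj m.+1};
  pc_bb : forall m x, pc_b m (pc_b m.+1 x) = 0;
  pc_BB : forall m x, pc_B m.+1 (pc_B m x) = 0;
  pc_T_iso : forall m, bijective (fun x => x - anticomm pc_b pc_B (m := m) x)
}.

Definition pc_T (C : parachain) m (x : C m) : C m :=
  x - anticomm (pc_b C) (pc_B C) x.

(* Powers of an operator of degree 2.  Note that j.+1.*2 + n is convertible to
   (j.*2 + n).+2. *)
Fixpoint iter2 (V : nat -> lmodType k) (A : forall n, {linear V n -> V n.+2})
    j n : {linear V n -> V (j.*2 + n)%N} :=
  match j with
  | 0 => idfun
  | j'.+1 => A (j'.*2 + n)%N \o iter2 A j' n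
  end.

Definition gcast (V : nat -> lmodType k) m n (e : m = n) (x : V m) : V n :=
  ecast i (V i) e x.

(** * The modules C^natural *)

(* An element x of C^natural_m = (+)_p C_(m-2p) u^p is the family of its
   coefficients: x p n e : C n is the coefficient of u^p, for n = m - 2p.
   Only finitely many pairs (p, n) satisfy e, so this product is the direct
   sum; carrying e avoids transports along equalities of degrees. *)
Definition cnat (C : nat -> lmodType k) m : lmodType k :=
  dprod (fun p : nat => dprod (fun n : nat =>
    dprod (fun _ : (p.*2 + n)%N = m => C n))).

(* Coefficientwise action of operators of degree 0, -1 and 1. *)
Definition nat_map (C D : nat -> lmodType k) (A : forall n, C n -> D n) m
    (x : cnat C m) : cnat D m :=
  fun p n e => A n (x p n e).

Fact nat_lower_idx p n m : (p.*2 + n = m -> p.*2 + n.+1 = m.+1)%N.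
Proof. lia. Qed.

Definition nat_lower (C D : nat -> lmodType k) (A : forall n, C n.+1 -> D n) m
    (x : cnat C m.+1) : cnat D m :=
  fun p n e => A n (x p n.+1 (nat_lower_idx e)).

Fact nat_raise_idx p n m : (p.*2 + n.+1 = m.+1 -> p.*2 + n = m)%N.
Proof. lia. Qed.

Definition nat_raise (C D : nat -> lmodType k) (A : forall n, C n -> D n.+1) m
    (x : cnat C m) : cnat D m.+1 :=
  fun p n =>
    match n return (p.*2 + n)%N = m.+1 -> D n with
    | 0 => fun _ => 0
    | n'.+1 => fun e => A n' (x p n' (nat_raise_idx e))
    end.

(* S = u^-1 : C^natural_(m+2) -> C^natural_m; on C^natural_0 and C^natural_1 it
   is 0, with values in negative degrees. *)
Fact uinv_idx p n m : (p.*2 + n = m -> p.+1.*2 + n = m.+2)%N.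
Proof. lia. Qed.

Definition uinv (C : nat -> lmodType k) m (x : cnat C m.+2) : cnat C m :=
  fun p n e => x p.+1 n (uinv_idx e).

Definition nat_T (C : parachain) m : cnat C m -> cnat C m :=
  nat_map (@pc_T C) (m := m).

(* d = b + B u^-1 *)
Definition nat_d (C : parachain) m : cnat C m.+1 -> cnat C m :=
  match m with
  | 0 => nat_lower (pc_b C) (m := 0)
  | m'.+1 => fun x =>
      nat_lower (pc_b C) x + nat_raise (pc_B C) (uinv x)
  end.

(* For h_j : C_n -> D_(n+2j), the degree 0 map sum_j h_j u^-j; the coefficient
   of u^p in h_j u^-j x is h_j (x_(p+j)). *)
Fact series_cod n (j : 'I_(n./2.+1)) : (j.*2 + (n - j.*2) = n)%N.
Proof. have := ltn_ord j; lia. Qed.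

Fact series_dom p n m (e : (p.*2 + n = m)%N) (j : 'I_(n./2.+1)) :
  ((p + j).*2 + (n - j.*2) = m)%N.
Proof. have := ltn_ord j; lia. Qed.

Definition nat_series (C D : nat -> lmodType k)
    (h : forall j n, {linear C n -> D (j.*2 + n)%N}) m (x : cnat C m) :
    cnat D m :=
  fun p n e => \sum_(j < n./2.+1)
    gcast (V := D) (series_cod j)
      (h j (n - j.*2)%N (x (p + j)%N (n - j.*2)%N (series_dom e j))).

(* Same for h_j : C_n -> D_(n+2j+1), giving a map of degree 1: regard h_j as
   taking values in D[1]_n = D_(n+1), then identify D[1]^natural_m with a
   submodule of D^natural_(m+1). *)
Definition nat_series1 (C D : nat -> lmodType k)
    (h : forall j n, {linear C n -> D (j.*2 + n).+1}) m (x : cnat C m) :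
    cnat D m.+1 :=
  nat_raise (C := fun n => D n.+1) (fun n y => y)
    (nat_series (D := fun n => D n.+1) h x).

Definition S_map (C D : parachain) (F : forall m, cnat C m -> cnat D m) : Prop :=
  [/\ forall m, linear (F m),
      forall m x, F m (nat_d x) = nat_d (F m.+1 x),
      forall m x, F m (uinv x) = uinv (F m.+2 x)
    & forall m x, F m (nat_T x) = nat_T (F m x)].

Definition coextension (C D : parachain) (g : forall m, {linear C m -> D m})
    (F : forall m, cnat C m -> cnat D m) : Prop :=
  S_map F /\
  exists h : forall j n, {linear C n -> D (j.*2 + n)%N},
    (forall n x, h 0%N n x = g n x) /\ (forall m x, F m x = nat_series h x).

(* In the third condition, u^-1 x is in C^natural_(-1) = 0. *)
Definition S_homotopy (C : parachain) (H : forall m, cnat C m -> cnat C m.+1) :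
    Prop :=
  [/\ forall m, linear (H m),
      forall m x, H m (uinv x) = uinv (H m.+2 x),
      forall x, uinv (H 1%N x) = 0
    & forall m x, H m (nat_T x) = nat_T (H m x)].

Definition S_deformation_retract (C D : parachain)
    (F : forall m, cnat C m -> cnat D m) (G : forall m, cnat D m -> cnat C m)
    (H : forall m, cnat C m -> cnat C m.+1) : Prop :=
  [/\ S_map F, S_map G, S_homotopy H,
      forall m y, F m (G m y) = y
    & forall m x, G m (F m x) = x + anticomm (@nat_d C) H x].

(** * The periodic para-complex C^sharp *)

Definition csharp_part (C : nat -> lmodType k) (i : nat) : lmodType k :=
  dprod (fun q : nat => C (i + q.*2)%N).

Definition csharp (C : nat -> lmodType k) : lmodType k :=
  (csharp_part C 0 * csharp_part C 1)%type.

Definition sharp_map (C D : nat -> lmodType k) (A : forall n, C n -> D n)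
    (x : csharp C) : csharp D :=
  ((fun q => A (0 + q.*2)%N (x.1 q)), (fun q => A (1 + q.*2)%N (x.2 q))).

Definition sharp_lower (C D : nat -> lmodType k) (A : forall n, C n.+1 -> D n)
    (x : csharp C) : csharp D :=
  ((fun q => A (0 + q.*2)%N (x.2 q)), (fun q => A (1 + q.*2)%N (x.1 q.+1))).

Definition sharp_raise (C D : nat -> lmodType k) (A : forall n, C n -> D n.+1)
    (x : csharp C) : csharp D :=
  ((fun q => match q return D (0 + q.*2)%N with
             | 0 => 0
             | q'.+1 => A (1 + q'.*2)%N (x.2 q')
             end),
   (fun q => A (0 + q.*2)%N (x.1 q))).

(* b + B *)
Definition sharp_d (C : parachain) (x : csharp C) : csharp C :=
  sharp_lower (pc_b C) x + sharp_raise (pc_B C) x.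

Definition sharp_T (C : parachain) : csharp C -> csharp C :=
  sharp_map (@pc_T C).

(* The infinite sum of the a j, when the components of a j in C_(2q+i) vanish
   for q < j. *)
Definition sharp_sum (C : nat -> lmodType k) (a : nat -> csharp C) : csharp C :=
  ((fun q => \sum_(j < q.+1) (a j).1 q), (fun q => \sum_(j < q.+1) (a j).2 q)).

Definition even_map (C D : nat -> lmodType k) (F : csharp C -> csharp D) : Prop :=
  (forall x0, (F (x0, 0)).2 = 0) /\ (forall x1, (F (0, x1)).1 = 0).

Definition odd_map (C D : nat -> lmodType k) (F : csharp C -> csharp D) : Prop :=
  (forall x0, (F (x0, 0)).1 = 0) /\ (forall x1, (F (0, x1)).2 = 0).

Definition T_map (C D : parachain) (F : csharp C -> csharp D) : Prop :=
  [/\ linear F, even_map F,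
      forall x, F (sharp_d x) = sharp_d (F x)
    & forall x, F (sharp_T x) = sharp_T (F x)].

Definition T_homotopy (C : parachain) (H : csharp C -> csharp C) : Prop :=
  [/\ linear H, odd_map H & forall x, H (sharp_T x) = sharp_T (H x)].

Definition T_deformation_retract (C D : parachain)
    (F : csharp C -> csharp D) (G : csharp D -> csharp C)
    (H : csharp C -> csharp C) : Prop :=
  [/\ T_map F, T_map G, T_homotopy H,
      forall y, F (G y) = y
    & forall x, G (F x) = x + (sharp_d (H x) + H (sharp_d x))].

(** * The perturbed maps *)

Section Perturbed.
Variables (C D : parachain).
Variables (f : forall m, {linear C m -> D m}) (g : forall m, {linear D m -> C m}).
Variable phi : forall m, {linear C m -> C m.+1}.

(* (phi B)^j g and phi (B phi)^j *)
Definition g_coef j n : {linear D n -> C (j.*2 + n)%N} :=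
  iter2 (fun n => phi n.+1 \o pc_B C n) j n \o g n.

Definition phi_coef j n : {linear C n -> C (j.*2 + n).+1} :=
  phi (j.*2 + n)%N \o iter2 (fun n => pc_B C n.+1 \o phi n) j n.

Definition f_nat m : cnat C m -> cnat D m := nat_map f (m := m).
Definition g_nat m : cnat D m -> cnat C m := nat_series g_coef (m := m).
Definition phi_nat m : cnat C m -> cnat C m.+1 := nat_series1 phi_coef (m := m).

(* The maps induced on the periodic complexes: since these are the inverse
   limits under S of the C^natural, u^-1 is to be replaced by 1. *)
Definition f_sharp : csharp C -> csharp D := sharp_map f.

Definition g_sharp (y : csharp D) : csharp C :=
  sharp_sum (fun j =>
    iter j (sharp_raise phi \o sharp_raise (pc_B C)) (sharp_map g y)).

Definition phi_sharp (x : csharp C) : csharp C :=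
  sharp_sum (fun j =>
    sharp_raise phi (iter j (sharp_raise (pc_B C) \o sharp_raise phi) x)).

End Perturbed.
End Graded.

(* Main.v *)
From HB Require Import structures.
Require Import Defs.
From mathcomp Require Import all_boot all_algebra.
From mathcomp Require Import boolp.

Set Implicit Arguments.
Unset Strict Implicit.
Unset Printing Implicit Defensive.

Import GRing.Theory.
Local Open Scope ring_scope.

(** The claims on C^natural and on C^sharp are instances of one perturbation
    lemma for ungraded modules.  Regard d = b + delta, with delta = B u^-1
    (or delta = B in the periodic case), as a perturbation of b.  The maps
    phi^natural and g^natural are the geometric series
    (1 - phi delta)^-1 phi and (1 - phi delta)^-1 g; that is, they solve
      g' = g + phi delta g'   and   phi' = phi + phi delta phi'.
    These two equations and the injectivity of 1 - phi delta are all that is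
    used about the series: linearity, equivariance and the homotopy formula
    z = w are obtained by checking that z and w solve the same equation
    x = a + phi delta x.

    The usual perturbation lemma assumes d^2 = 0, whereas here
    d^2 = b delta + delta b.  This operator is S (1 - T) (or 1 - T), so it
    commutes with phi, and phi phi' = 0 then makes the extra term
    phi (b delta + delta b) phi' in the homotopy formula vanish
    ([b_perturbed_phi], [perturbed_gf]).  It also commutes with phi', so the
    homotopy formula makes d commute with g' f; as f commutes with d and is
    onto, d commutes with g' ([perturbed_g_d]).  Because f commutes with b and
    delta and f phi = 0, the perturbation leaves f and the operator d on the
    target as they are.

    The lemma is applied twice.  For C^natural it is applied to the product
    [coefs C] of one copy of C_n for every monomial u^p and every n, on which
    the operators act without any bookkeeping of total degrees; each
    C^natural_m is a quotient of it, by a projection [coefs_at] compatible with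
    all the operators.  For the periodic complexes it is applied to [csharp C]
    itself.  In both cases 1 - phi delta is injective since phi delta raises
    the degree n by 2, and the explicit sums are shown to solve the two
    equations ([coefs_series_rec], [sharp_sum_geometric]). *)

(** * The perturbation lemma *)

Section Perturbation.
Variables (k : pzRingType) (M N : lmodType k).
Variables (b delta phi : {linear M -> M}) (bN deltaN : {linear N -> N}).
Variables (f : {linear M -> N}) (g : {linear N -> M}).
Variables (g' : N -> M) (phi' : M -> M).

Hypothesis phidelta_inj : forall x, x = phi (delta x) -> x = 0.
Hypothesis g'E : forall y, g' y = g y + phi (delta (g' y)).
Hypothesis phi'E : forall x, phi' x = phi x + phi (delta (phi' x)).

(** Stands in for all manipulations of the series: to identify z with w, write
    both as a plus their image under phi delta. *)
Lemma perturb_uniq a z w :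
  z = a + phi (delta z) -> w = a + phi (delta w) -> z = w.
Proof.
move=> hz hw; apply/eqP; rewrite -subr_eq0; apply/eqP; apply: phidelta_inj.
by rewrite {1}hz {1}hw !linearB /= opprD addrACA subrr add0r.
Qed.

Lemma perturbed_g_linear : linear g'.
Proof.
move=> a y z; apply: (perturb_uniq (g'E _)).
by rewrite {1}(g'E y) {1}(g'E z) !linearP /= scalerDr addrACA.
Qed.

Lemma perturbed_phi_linear : linear phi'.
Proof.
move=> a y z; apply: (perturb_uniq (phi'E _)).
by rewrite {1}(phi'E y) {1}(phi'E z) !linearP /= scalerDr addrACA.
Qed.

(** Any operator that commutes with phi, delta and g commutes with the
    solutions g' and phi'.  This will serve for T, for S and for d^2. *)
Section Equivariance.
Variables (Q : M -> M) (QN : N -> N).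
Hypothesis QD : {morph Q : x y / x + y}.
Hypothesis Q_delta : forall x, Q (delta x) = delta (Q x).
Hypothesis Q_phi : forall x, Q (phi x) = phi (Q x).
Hypothesis Q_g : forall y, Q (g y) = g (QN y).

Lemma perturbed_g_equivariant y : g' (QN y) = Q (g' y).
Proof.
by apply: (perturb_uniq (g'E _)); rewrite {1}g'E QD Q_g Q_phi Q_delta.
Qed.

Lemma perturbed_phi_equivariant x : phi' (Q x) = Q (phi' x).
Proof.
by apply: (perturb_uniq (phi'E _)); rewrite {1}phi'E QD !Q_phi Q_delta.
Qed.
End Equivariance.

Hypothesis fg : forall y, f (g y) = y.
Hypothesis gf : forall x, g (f x) = x + (b (phi x) + phi (b x)).
Hypothesis f_b : forall x, f (b x) = bN (f x).
Hypothesis f_delta : forall x, f (delta x) = deltaN (f x).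
Hypothesis f_phi : forall x, f (phi x) = 0.
Hypothesis phi_g : forall y, phi (g y) = 0.
Hypothesis phi_phi : forall x, phi (phi x) = 0.
Hypothesis bb : forall x, b (b x) = 0.
Hypothesis dd : forall x, delta (delta x) = 0.
Hypothesis phi_anticomm : forall x,
  phi (b (delta x) + delta (b x)) = b (delta (phi x)) + delta (b (phi x)).

Lemma f_perturbed_g y : f (g' y) = y.
Proof. by rewrite g'E linearD fg f_phi addr0. Qed.

Lemma f_perturbed_phi x : f (phi' x) = 0.
Proof. by rewrite phi'E linearD !f_phi addr0. Qed.

Lemma phi_perturbed_g y : phi (g' y) = 0.
Proof. by rewrite g'E linearD phi_g phi_phi addr0. Qed.

Lemma phi_perturbed_phi x : phi (phi' x) = 0.
Proof. by rewrite phi'E linearD !phi_phi addr0. Qed.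

Lemma perturbed_phi_g y : phi' (g' y) = 0.
Proof. by apply: phidelta_inj; rewrite {1}phi'E phi_perturbed_g add0r. Qed.

Lemma perturbed_phi_phi x : phi' (phi' x) = 0.
Proof. by apply: phidelta_inj; rewrite {1}phi'E phi_perturbed_phi add0r. Qed.

(** The place where d^2 <> 0 enters: b delta + delta b can be moved past phi,
    and phi phi' = 0. *)
Lemma phi_b_delta_perturbed_phi x :
  phi (delta (b (phi' x))) = - phi (b (delta (phi' x))).
Proof.
apply/eqP; rewrite -addr_eq0 -linearD addrC /= phi_anticomm phi_perturbed_phi.
by rewrite !linear0 addr0.
Qed.

(** This is the homotopy formula g f = 1 + b phi + phi b at delta phi' x, whose
    left-hand side vanishes because f delta phi' = delta f phi' = 0. *)
Lemma b_perturbed_phi x :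
  b (phi' x) + delta (phi' x) = b (phi x) + phi (delta (b (phi' x))).
Proof.
set w := phi' x.
have fdw : f (delta w) = 0 by rewrite f_delta f_perturbed_phi linear0.
have /esym/eqP := gf (delta w); rewrite fdw linear0 addrCA addr_eq0 => /eqP bpd.
rewrite {1}/w phi'E linearD -addrA bpd -/w phi_b_delta_perturbed_phi opprD.
by rewrite addrAC addNr add0r.
Qed.

Lemma perturbed_gf x : g' (f x) =
  x + (b (phi' x) + delta (phi' x) + phi' (b x + delta x)).
Proof.
apply: (perturb_uniq (g'E _)).
rewrite [in LHS]b_perturbed_phi [in LHS](phi'E (b x + delta x)) gf.
rewrite !linearD /= dd linear0 addr0 -!addrA; congr (_ + (_ + _)).
by rewrite [in LHS]addrCA; congr (_ + _); rewrite [in LHS]addrCA.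
Qed.

(** Since b^2 = delta^2 = 0, the operator d^2 is b delta + delta b, to which
    equivariance applies: it commutes with delta as delta^2 = 0. *)
Lemma perturbed_phi_dd (d := fun x => b x + delta x) x :
  phi' (d (d x)) = d (d (phi' x)).
Proof.
pose Q x := b (delta x) + delta (b x).
have ddQ z : d (d z) = Q z by rewrite /d !linearD bb dd add0r addr0.
rewrite !ddQ; apply: (perturbed_phi_equivariant (Q := Q)) => [y z|z|z].
- by rewrite /Q !linearD addrACA.
- by rewrite /Q linearD /= !dd linear0 add0r addr0.
- by rewrite /Q phi_anticomm.
Qed.

(** By the homotopy formula, d g' f = d + d^2 phi' + d phi' d and
    g' f d = d + d phi' d + phi' d^2, which agree; and f is onto. *)
Lemma perturbed_g_d y :
  g' (bN y + deltaN y) = b (g' y) + delta (g' y).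
Proof.
rewrite -(fg y); set x := g y.
rewrite -f_b -f_delta -linearD !perturbed_gf.
have := perturbed_phi_dd x; rewrite /= => ->.
by rewrite !linearD /= !bb !dd add0r addr0 !addrA [RHS](ACl (1*4*3*6*2*5)%AC).
Qed.

Theorem special_perturbation (d := fun x => b x + delta x) :
  [/\ forall y, g' (bN y + deltaN y) = d (g' y),
      forall y, f (g' y) = y,
      forall x, g' (f x) = x + (d (phi' x) + phi' (d x))
    & [/\ forall x, f (phi' x) = 0,
          forall y, phi' (g' y) = 0
        & forall x, phi' (phi' x) = 0]].
Proof.
split; [exact: perturbed_g_d | exact: f_perturbed_g | exact: perturbed_gf |].
split; [exact: f_perturbed_phi | exact: perturbed_phi_g |].
exact: perturbed_phi_phi.
Qed.
End Perturbation.

(** * The operator T *)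

Section Anticomm.
Variables (k : pzRingType) (V : nat -> lmodType k).

Lemma anticomm_linear (lo : forall m, {linear V m.+1 -> V m})
  (up : forall m, {linear V m -> V m.+1}) m : linear (anticomm lo up (m := m)).
Proof.
by case: m => [|m] a x y /=; rewrite !linearP // scalerDr addrACA.
Qed.
HB.instance Definition _ (lo : forall m, {linear V m.+1 -> V m})
  (up : forall m, {linear V m -> V m.+1}) m :=
  GRing.isLinear.Build k _ _ _ (@anticomm k V lo up m)
    (anticomm_linear lo up (m := m)).
End Anticomm.

Section ParachainT.
Variables (k : pzRingType) (C : parachain k).

Lemma pc_T_linear m : linear (@pc_T k C m).
Proof.
move=> a x y; rewrite /pc_T (anticomm_linear (pc_b C) (pc_B C)).
by rewrite scalerBr opprD addrACA.
Qed.

(** Both sides are B - B b B, as B^2 = 0. *)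
Lemma pc_T_B m (x : C m) : pc_T (pc_B C m x) = pc_B C m (pc_T x).
Proof.
by rewrite /pc_T linearB; congr (_ - _); case: m x => [|m] x /=;
  rewrite ?linearD /= !pc_BB ?linear0 ?addr0 ?add0r.
Qed.

Lemma anticomm_phi (phi : forall m, {linear C m -> C m.+1}) :
  (forall m x, phi m (pc_T x) = pc_T (phi m x)) ->
  forall m x, phi m (anticomm (pc_b C) (pc_B C) x) =
              anticomm (pc_b C) (pc_B C) (phi m x).
Proof.
move=> phi_T m x; have := phi_T m x.
by rewrite /pc_T linearB => /addrI/oppr_inj.
Qed.

HB.instance Definition _ m :=
  GRing.isLinear.Build k _ _ _ (@pc_T k C m) (@pc_T_linear m).
End ParachainT.

(** * Families of coefficients *)

Section Coefficients.
Variable k : pzRingType.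
Implicit Types C D E : nat -> lmodType k.

(** Formal sums of x_(p,n) u^p with x_(p,n) in C_n: the product over all m of
    the modules C^natural_m.  Without the constraint 2p + n = m no equality
    between degrees has to be carried along. *)
Definition coefs C : lmodType k := dprod (fun p : nat => dprod (fun n => C n)).

Definition coefs_map C D (A : forall n, C n -> D n) (y : coefs C) : coefs D :=
  fun p n => A n (y p n).

Definition coefs_lower C D (A : forall n, C n.+1 -> D n) (y : coefs C) :
    coefs D :=
  fun p n => A n (y p n.+1).

Definition coefs_raise C D (A : forall n, C n -> D n.+1) (y : coefs C) :
    coefs D :=
  fun p n => match n with 0 => 0 | n'.+1 => A n' (y p n') end.

Definition coefs_uinv C (y : coefs C) : coefs C := fun p n => y p.+1 n.

Lemma coefsP C (y z : coefs C) : (forall p n, y p n = z p n) -> y = z.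
Proof.
move=> yz; apply: functional_extensionality_dep => p.
by apply: functional_extensionality_dep => n.
Qed.

Lemma coefs_map_linear C D (A : forall n, {linear C n -> D n}) :
  linear (coefs_map A).
Proof. by move=> a y z; apply: coefsP => p n; exact: linearP. Qed.
HB.instance Definition _ C D (A : forall n, {linear C n -> D n}) :=
  GRing.isLinear.Build k _ _ _ (coefs_map A) (coefs_map_linear A).

Lemma coefs_lower_linear C D (A : forall n, {linear C n.+1 -> D n}) :
  linear (coefs_lower A).
Proof. by move=> a y z; apply: coefsP => p n; exact: linearP. Qed.
HB.instance Definition _ C D (A : forall n, {linear C n.+1 -> D n}) :=
  GRing.isLinear.Build k _ _ _ (coefs_lower A) (coefs_lower_linear A).

Lemma coefs_raise_linear C D (A : forall n, {linear C n -> D n.+1}) :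
  linear (coefs_raise A).
Proof.
move=> a y z; apply: coefsP => p [|n]; last exact: linearP.
by apply/esym; rewrite -[RHS](scaler0 _ a) -[RHS]addr0.
Qed.
HB.instance Definition _ C D (A : forall n, {linear C n -> D n.+1}) :=
  GRing.isLinear.Build k _ _ _ (coefs_raise A) (coefs_raise_linear A).

Lemma coefs_uinv_linear C : linear (@coefs_uinv C).
Proof. by []. Qed.
HB.instance Definition _ C :=
  GRing.isLinear.Build k _ _ _ (@coefs_uinv C) (@coefs_uinv_linear C).

Lemma coefs_anticomm C (lo : forall n, C n.+1 -> C n)
    (up : forall n, C n -> C n.+1) (y : coefs C) :
  coefs_lower lo (coefs_raise up y) + coefs_raise up (coefs_lower lo y) =
  coefs_map (anticomm lo up) y.
Proof. by apply: coefsP => p [|n] //; exact: addr0. Qed.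

Lemma coefs_raise_raise C D E (A : forall n, {linear D n -> E n.+1})
    (A' : forall n, C n -> D n.+1) :
  (forall n x, A n.+1 (A' n x) = 0) ->
  forall y, coefs_raise A (coefs_raise A' y) = 0.
Proof.
by move=> AA' y; apply: coefsP => p [|[|n]] //; [exact: linear0 | exact: AA'].
Qed.

Lemma coefs_map_raise C C' D D' (A : forall n, {linear C' n -> D' n})
    (A' : forall n, C n -> D n) (U' : forall n, C n -> C' n.+1)
    (U : forall n, D n -> D' n.+1) :
  (forall n x, A n.+1 (U' n x) = U n (A' n x)) ->
  forall y, coefs_map A (coefs_raise U' y) = coefs_raise U (coefs_map A' y).
Proof.
by move=> AU y; apply: coefsP => p [|n]; [exact: linear0 | exact: AU].
Qed.

(** The projection to total degree m.  It commutes by conversion with all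
    operators, except those that case on the degree. *)
Definition coefs_at C m (y : coefs C) : cnat C m := fun p n _ => y p n.

Arguments coefs_at {C} m y.

Lemma coefs_at_surj C m (x : cnat C m) : exists y, x = coefs_at m y.
Proof.
exists (fun p n => if (p.*2 + n)%N =P m is ReflectT e then x p n e else 0).
apply: functional_extensionality_dep => p.
apply: functional_extensionality_dep => n.
apply: functional_extensionality_dep => e.
rewrite /coefs_at; case: eqP => [e'|//]; congr (x p n _); exact: eq_irrelevance.
Qed.

Lemma coefs_atD C m (y z : coefs C) :
  coefs_at m y + coefs_at m z = coefs_at m (y + z).
Proof. by []. Qed.

Lemma coefs_at_linear C m : linear (coefs_at (C := C) m).
Proof. by []. Qed.

Lemma nat_raise_at C D (A : forall n, C n -> D n.+1) m (y : coefs C) :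
  nat_raise A (coefs_at m y) = coefs_at m.+1 (coefs_raise A y).
Proof.
apply: functional_extensionality_dep => p.
by apply: functional_extensionality_dep => -[|n].
Qed.

Definition coefs_series C D (h : forall j n, {linear C n -> D (j.*2 + n)%N})
    (y : coefs C) : coefs D :=
  fun p n => \sum_(j < n./2.+1)
    gcast (V := D) (series_cod j)
      (h j (n - j.*2)%N (y (p + j)%N (n - j.*2)%N)).

Section Series.
Variables (C D : nat -> lmodType k) (A : forall n, {linear D n -> D n.+2}).
Variables (h0 : forall n, {linear C n -> D n}).
Variable h : forall j n, {linear C n -> D (j.*2 + n)%N}.
Hypothesis h0E : forall n x, h 0%N n x = h0 n x.
Hypothesis hS : forall j n x, h j.+1 n x = A (j.*2 + n)%N (h j n x).

Lemma coefs_series_head (y : coefs C) p n (e : (0.*2 + (n - 0.*2) = n)%N) :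
  gcast (V := D) e (h 0%N (n - 0.*2)%N (y (p + 0)%N (n - 0.*2)%N)) =
  h0 n (y p n).
Proof.
move: e; rewrite addn0; move: (n - 0.*2)%N => l e.
by case: _ / e; exact: h0E.
Qed.

Lemma coefs_series_step (y : coefs C) p n j
    (e' : (j.+1.*2 + (n.+2 - j.+1.*2) = n.+2)%N)
    (e : (j.*2 + (n - j.*2) = n)%N) :
  gcast (V := D) e'
    (h j.+1 (n.+2 - j.+1.*2)%N (y (p + j.+1)%N (n.+2 - j.+1.*2)%N)) =
  A n (gcast (V := D) e (h j (n - j.*2)%N (y (p.+1 + j)%N (n - j.*2)%N))).
Proof.
rewrite -addSnnS; move: e' e.
(* These two degrees are convertible; abstracting the common value l leaves
   equations e and e' that can be eliminated. *)
change (n.+2 - j.+1.*2)%N with (n - j.*2)%N.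
move: (n - j.*2)%N => l e' e; rewrite hS.
change ((j.*2 + l).+2 = n.+2) in e'.
by move: e'; case: _ / e => e'; rewrite (eq_irrelevance e' erefl).
Qed.

(** If h_(j+1) = A h_j, then the series H = sum_j h_j u^-j satisfies
    H = h_0 + A u^-1 H, where A u^-1 has no component in degrees n < 2. *)
Lemma coefs_series_rec (y : coefs C) p n :
  coefs_series h y p n = h0 n (y p n) +
    (if n is n'.+2 then A n' (coefs_series h y p.+1 n') else 0).
Proof.
rewrite /coefs_series big_ord_recl coefs_series_head; congr (_ + _).
case: n => [|[|n]] /=; rewrite ?big_ord0 //.
rewrite linear_sum; apply: eq_bigr => j _; exact: coefs_series_step.
Qed.
End Series.

End Coefficients.

Arguments coefs_at {k C} m y.

(** * Operators on the periodic complex *)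

Section Periodic.
Variable k : pzRingType.
Implicit Types C D E : nat -> lmodType k.

Lemma csharpP C (x y : csharp C) :
  (forall q, x.1 q = y.1 q) -> (forall q, x.2 q = y.2 q) -> x = y.
Proof.
case: x y => [x1 x2] [y1 y2] /= xy1 xy2; congr pair;
  exact: functional_extensionality_dep.
Qed.

Lemma sharp_map_linear C D (A : forall n, {linear C n -> D n}) :
  linear (sharp_map A).
Proof. by move=> a y z; apply: csharpP => q; exact: linearP. Qed.
HB.instance Definition _ C D (A : forall n, {linear C n -> D n}) :=
  GRing.isLinear.Build k _ _ _ (sharp_map A) (sharp_map_linear A).

Lemma sharp_lower_linear C D (A : forall n, {linear C n.+1 -> D n}) :
  linear (sharp_lower A).
Proof. by move=> a y z; apply: csharpP => q; exact: linearP. Qed.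
HB.instance Definition _ C D (A : forall n, {linear C n.+1 -> D n}) :=
  GRing.isLinear.Build k _ _ _ (sharp_lower A) (sharp_lower_linear A).

Lemma sharp_raise_linear C D (A : forall n, {linear C n -> D n.+1}) :
  linear (sharp_raise A).
Proof.
move=> a y z; apply: csharpP => [[|q]|q]; try exact: linearP.
by apply/esym; rewrite -[RHS](scaler0 _ a) -[RHS]addr0.
Qed.
HB.instance Definition _ C D (A : forall n, {linear C n -> D n.+1}) :=
  GRing.isLinear.Build k _ _ _ (sharp_raise A) (sharp_raise_linear A).

Lemma sharp_anticomm C (lo : forall n, C n.+1 -> C n)
    (up : forall n, C n -> C n.+1) (y : csharp C) :
  sharp_lower lo (sharp_raise up y) + sharp_raise up (sharp_lower lo y) =
  sharp_map (anticomm lo up) y.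
Proof. by apply: csharpP => [[|q]|q] //; exact: addr0. Qed.

Lemma sharp_raise_raise C D E (A : forall n, {linear D n -> E n.+1})
    (A' : forall n, C n -> D n.+1) :
  (forall n x, A n.+1 (A' n x) = 0) ->
  forall y, sharp_raise A (sharp_raise A' y) = 0.
Proof.
move=> AA' y; apply: csharpP => [[|q]|[|q]] //; try exact: AA'.
exact: linear0.
Qed.

Lemma sharp_map_raise C C' D D' (A : forall n, {linear C' n -> D' n})
    (A' : forall n, C n -> D n) (U' : forall n, C n -> C' n.+1)
    (U : forall n, D n -> D' n.+1) :
  (forall n x, A n.+1 (U' n x) = U n (A' n x)) ->
  forall y, sharp_map A (sharp_raise U' y) = sharp_raise U (sharp_map A' y).
Proof.
by move=> AU y; apply: csharpP => [[|q]|q]; [exact: linear0 | exact: AU..].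
Qed.

(** The component of s in C_(2q+i) is the sum of the terms with j <= q; its
    terms with j > 0 come from the component in C_(2(q-1)+i), where the sum runs
    over j <= q - 1, which is why the truncations of [sharp_sum] match. *)
Lemma sharp_sum_geometric C (U V : forall n, {linear C n -> C n.+1})
    (a : csharp C)
    (s := sharp_sum (fun j => iter j (sharp_raise U \o sharp_raise V) a)) :
  s = a + sharp_raise U (sharp_raise V s).
Proof.
apply: csharpP => q; rewrite {1}/s /= big_ord_recl; congr (_ + _).
  case: q => [|q]; first by rewrite big_ord0.
  by rewrite /= !linear_sum.
case: q => [|q]; first by rewrite big_ord0 /= linear0.
by rewrite /= !linear_sum.
Qed.
End Periodic.

(** * The perturbed maps on natural complexes *)

Section PerturbedMaps.
Variables (k : pzRingType) (C D : parachain k).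
Variable f : forall m, {linear C m -> D m}.
Variable g : forall m, {linear D m -> C m}.
Variable phi : forall m, {linear C m -> C m.+1}.

Definition coefs_d (E : parachain k) (y : coefs E) : coefs E :=
  coefs_lower (pc_b E) y + coefs_raise (pc_B E) (coefs_uinv y).
Definition coefs_g : coefs D -> coefs C := coefs_series (g_coef g phi).
Definition coefs_phi (y : coefs C) : coefs C :=
  coefs_raise (C := fun n => C n.+1) (fun n x => x)
    (coefs_series (D := fun n => C n.+1) (phi_coef phi) y).

Lemma coefs_gE y : coefs_g y = coefs_map g y +
  coefs_raise phi (coefs_raise (pc_B C) (coefs_uinv (coefs_g y))).
Proof.
apply: coefsP => p n.
rewrite {1}/coefs_g.
rewrite (coefs_series_rec (A := fun n => phi n.+1 \o pc_B C n) (h0 := g)) //.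
case: n => [|[|n]] //.
by congr (_ + _); rewrite /= linear0.
Qed.

Lemma coefs_phiE y : coefs_phi y = coefs_raise phi y +
  coefs_raise phi (coefs_raise (pc_B C) (coefs_uinv (coefs_phi y))).
Proof.
apply: coefsP => p [|n]; first by rewrite -[RHS]/(0 + 0) addr0.
rewrite /coefs_phi /=.
rewrite (coefs_series_rec (A := fun n => phi n.+2 \o pc_B C n.+1)
  (h0 := phi)) //.
by case: n => [|[|n]] //; congr (_ + _); rewrite /= /coefs_uinv /= !linear0.
Qed.

Lemma coefs_phiB_inj x :
  x = coefs_raise phi (coefs_raise (pc_B C) (coefs_uinv x)) -> x = 0.
Proof.
move=> xE; apply: coefsP => p n.
(* Two consecutive degrees, because phi B raises degrees by 2. *)
suff: x p n = 0 /\ x p n.+1 = 0 by case.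
elim: n p => [|n IHn] p.
  by split; rewrite xE //=; rewrite linear0.
split; first by case: (IHn p).
by rewrite xE /= /coefs_uinv; case: (IHn p.+1) => -> _; rewrite !linear0.
Qed.

Hypothesis f_b : forall m x, f m (pc_b C m x) = pc_b D m (f m.+1 x).
Hypothesis fg : forall m y, f m (g m y) = y.
Hypothesis gf : forall m x, g m (f m x) = x + anticomm (pc_b C) phi x.
Hypothesis f_B : forall m x, f m.+1 (pc_B C m x) = pc_B D m (f m x).
Hypothesis g_T : forall m y, g m (pc_T y) = pc_T (g m y).
Hypothesis phi_T : forall m x, phi m (pc_T x) = pc_T (phi m x).
Hypothesis phi_special : special f g phi.

Let delta (E : parachain k) : {linear coefs E -> coefs E} :=
  coefs_raise (pc_B E) \o @coefs_uinv _ E.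

Lemma coefs_perturbation :
  [/\ forall y, coefs_g (coefs_d y) = coefs_d (coefs_g y),
      forall y, coefs_map f (coefs_g y) = y,
      forall x, coefs_g (coefs_map f x) =
        x + (coefs_d (coefs_phi x) + coefs_phi (coefs_d x))
    & [/\ forall x, coefs_map f (coefs_phi x) = 0,
          forall y, coefs_phi (coefs_g y) = 0
        & forall x, coefs_phi (coefs_phi x) = 0]].
Proof.
have [f_phi phi_g phi_phi] := phi_special.
apply: (@special_perturbation _ _ _ (coefs_lower (pc_b C)) (delta C)
  (coefs_raise phi) (coefs_lower (pc_b D)) (delta D)
  (coefs_map f) (coefs_map g)).
- exact: coefs_phiB_inj.
- exact: coefs_gE.
- exact: coefs_phiE.
- by move=> y; apply: coefsP => p n; exact: fg.
- by move=> x; rewrite /= coefs_anticomm; apply: coefsP => p n; exact: gf.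
- by move=> x; apply: coefsP => p n; exact: f_b.
- by move=> x; rewrite /= (coefs_map_raise (A' := f) (U := pc_B D)).
- by move=> x; apply: coefsP => p [|n]; [exact: linear0 | exact: f_phi].
- by move=> x; apply: coefsP => p [|n] //; exact: phi_g.
- exact: coefs_raise_raise.
- by move=> x; apply: coefsP => p n; exact: pc_bb.
- by move=> x; exact: (coefs_raise_raise (@pc_BB _ C)).
- move=> x /=; rewrite !coefs_anticomm.
  rewrite [RHS](coefs_map_raise
    (A' := anticomm (pc_b C) (pc_B C)) (U := phi)) //.
  by move=> n z; rewrite (anticomm_phi phi_T).
Qed.

Lemma coefs_T_additive : {morph coefs_map (@pc_T _ C) : x y / x + y}.
Proof. by move=> x y; apply: coefsP => p n; exact: linearD. Qed.

Lemma coefs_raise_T (up : forall m, {linear C m -> C m.+1}) :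
  (forall m x, up m (pc_T x) = pc_T (up m x)) -> forall y,
  coefs_map (@pc_T _ C) (coefs_raise up y) =
  coefs_raise up (coefs_map (@pc_T _ C) y).
Proof. by move=> up_T; apply: coefs_map_raise => m x; rewrite up_T. Qed.

Lemma coefs_g_uinv y : coefs_g (coefs_uinv y) = coefs_uinv (coefs_g y).
Proof.
exact: (perturbed_g_equivariant (delta := delta C) (phi := coefs_raise phi)
  coefs_phiB_inj coefs_gE (Q := @coefs_uinv _ C)).
Qed.

Lemma coefs_phi_uinv x : coefs_phi (coefs_uinv x) = coefs_uinv (coefs_phi x).
Proof.
exact: (perturbed_phi_equivariant (delta := delta C) (phi := coefs_raise phi)
  coefs_phiB_inj coefs_phiE (Q := @coefs_uinv _ C)).
Qed.

Lemma coefs_g_T y :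
  coefs_g (coefs_map (@pc_T _ D) y) = coefs_map (@pc_T _ C) (coefs_g y).
Proof.
apply: (perturbed_g_equivariant (delta := delta C) (phi := coefs_raise phi)
  coefs_phiB_inj coefs_gE) => [x z|x|x|x].
- exact: coefs_T_additive.
- by apply: coefs_raise_T => m z; rewrite pc_T_B.
- exact: coefs_raise_T.
- by apply: coefsP => p n; exact/esym/g_T.
Qed.

Lemma coefs_phi_T x :
  coefs_phi (coefs_map (@pc_T _ C) x) = coefs_map (@pc_T _ C) (coefs_phi x).
Proof.
apply: (perturbed_phi_equivariant (delta := delta C) (phi := coefs_raise phi)
  coefs_phiB_inj coefs_phiE) => [{}x z|{}x|{}x].
- exact: coefs_T_additive.
- by apply: coefs_raise_T => m z; rewrite pc_T_B.
- exact: coefs_raise_T.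
Qed.

Lemma nat_d_at (E : parachain k) m (y : coefs E) :
  nat_d (coefs_at m.+1 y) = coefs_at m (coefs_d y).
Proof.
case: m => [|m] /=; last by rewrite (nat_raise_at (pc_B E) m (coefs_uinv y)).
apply: functional_extensionality_dep => p.
apply: functional_extensionality_dep => n.
apply: functional_extensionality_dep => e.
by case: n e => [|n] e; [exact/esym/addr0 | have := e; rewrite addnS].
Qed.

Lemma phi_nat_at m (y : coefs C) :
  phi_nat phi (coefs_at m y) = coefs_at m.+1 (coefs_phi y).
Proof.
exact: (nat_raise_at (C := fun n => C n.+1) (fun n x => x) m
   (coefs_series (D := fun n => C n.+1) (phi_coef phi) y)).
Qed.

(** In degree 0 the term phi' d of the homotopy formula factors through
    degree -1, so it has to vanish on [coefs C] as well. *)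
Lemma coefs_at0_phi (y : coefs C) : coefs_at 0 (coefs_phi y) = 0.
Proof.
apply: functional_extensionality_dep => p.
apply: functional_extensionality_dep => n.
apply: functional_extensionality_dep => e.
by case: n e => [|n] // e; have := e; rewrite addnS.
Qed.

Lemma anticomm_nat_at m (y : coefs C) :
  anticomm (@nat_d k C) (phi_nat phi) (coefs_at m y) =
  coefs_at m (coefs_d (coefs_phi y) + coefs_phi (coefs_d y)).
Proof.
case: m => [|m]; rewrite /anticomm phi_nat_at nat_d_at -coefs_atD.
  by rewrite coefs_at0_phi addr0.
by rewrite nat_d_at phi_nat_at.
Qed.

Lemma coefs_map_d x : coefs_map f (coefs_d x) = coefs_d (coefs_map f x).
Proof.
rewrite /coefs_d linearD /= (coefs_map_raise (A' := f) (U := pc_B D)) //.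
by congr (_ + _); apply: coefsP => p n; exact: f_b.
Qed.

Lemma f_T m x : f m (pc_T x) = pc_T (f m x).
Proof.
rewrite /pc_T linearB; congr (_ - _).
by case: m x => [|m] x /=; rewrite ?linearD /= ?f_b ?f_B ?f_b.
Qed.

Lemma coefs_map_T x :
  coefs_map f (coefs_map (@pc_T _ C) x) = coefs_map (@pc_T _ D) (coefs_map f x).
Proof. by apply: coefsP => p n; exact: f_T. Qed.

Lemma nat_perturbation :
  [/\ S_map (g_nat g phi), coextension g (g_nat g phi),
      S_deformation_retract (f_nat f) (g_nat g phi) (phi_nat phi)
    & special (f_nat f) (g_nat g phi) (phi_nat phi)].
Proof.
have [gd fgc gfc [fp pg pp]] := coefs_perturbation.
have gL : linear coefs_g.
  exact: (perturbed_g_linear (delta := delta C) (phi := coefs_raise phi)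
    coefs_phiB_inj coefs_gE).
have phiL : linear coefs_phi.
  exact: (perturbed_phi_linear (delta := delta C) (phi := coefs_raise phi)
    coefs_phiB_inj coefs_phiE).
have g_at m y : g_nat g phi (coefs_at m y) = coefs_at m (coefs_g y) by [].
have gS : S_map (g_nat g phi).
  split=> [m a x y|m x|m x|m x]; have [{}x ->] := coefs_at_surj x.
  - have [{}y ->] := coefs_at_surj y.
    by rewrite -coefs_at_linear !g_at gL coefs_at_linear.
  - by rewrite nat_d_at !g_at nat_d_at gd.
  - by rewrite -[uinv _]/(coefs_at m (coefs_uinv x)) !g_at coefs_g_uinv.
  - rewrite -[nat_T _]/(coefs_at m (coefs_map (@pc_T _ D) x)) !g_at.
    by rewrite coefs_g_T.
split=> //.
- by split=> //; exists (g_coef g phi).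
- split=> //.
  + split=> [m a x y|m x|m x|m x]; have [{}x ->] := coefs_at_surj x.
    * have [{}y ->] := coefs_at_surj y.
      rewrite -coefs_at_linear -[LHS]/(coefs_at m (coefs_map f _)) linearP.
      by rewrite coefs_at_linear.
    * rewrite !nat_d_at -[LHS]/(coefs_at m (coefs_map f _)).
      rewrite -[f_nat _ _]/(coefs_at m.+1 (coefs_map f x)) nat_d_at.
      by rewrite coefs_map_d.
    * by [].
    * exact: (congr1 (coefs_at m) (coefs_map_T x)).
  + split=> [m a x y|m x|x|m x].
    * have [{}x ->] := coefs_at_surj x; have [{}y ->] := coefs_at_surj y.
      by rewrite -coefs_at_linear !phi_nat_at phiL coefs_at_linear.
    * have [{}x ->] := coefs_at_surj x.
      rewrite -[uinv _]/(coefs_at m (coefs_uinv x)) !phi_nat_at.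
      by rewrite coefs_phi_uinv.
    * have [{}x ->] := coefs_at_surj x.
      by rewrite phi_nat_at -[LHS]/(coefs_at 0 (coefs_uinv (coefs_phi x)))
        -coefs_phi_uinv coefs_at0_phi.
    * have [{}x ->] := coefs_at_surj x.
      rewrite -[nat_T _]/(coefs_at m (coefs_map (@pc_T _ C) x)) !phi_nat_at.
      by rewrite coefs_phi_T.
  + move=> m y; have [{}y ->] := coefs_at_surj y.
    by rewrite g_at -[LHS]/(coefs_at m (coefs_map f _)) fgc.
  + move=> m x; have [{}x ->] := coefs_at_surj x.
    by rewrite anticomm_nat_at coefs_atD -gfc; exact: g_at.
- split=> [m x|m y|m x].
  + have [{}x ->] := coefs_at_surj x.
    by rewrite phi_nat_at -[LHS]/(coefs_at m.+1 (coefs_map f _)) fp.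
  + by have [{}y ->] := coefs_at_surj y; rewrite g_at phi_nat_at pg.
  + by have [{}x ->] := coefs_at_surj x; rewrite !phi_nat_at pp.
Qed.

(** * The perturbed maps on periodic complexes *)

Lemma sharp_gE y : g_sharp g phi y = sharp_map g y +
  sharp_raise phi (sharp_raise (pc_B C) (g_sharp g phi y)).
Proof. exact: (sharp_sum_geometric phi (pc_B C)). Qed.

Lemma sharp_phiE x : phi_sharp phi x = sharp_raise phi x +
  sharp_raise phi (sharp_raise (pc_B C) (phi_sharp phi x)).
Proof.
(* phi (B phi)^j = (phi B)^j phi *)
suff -> : phi_sharp phi x = sharp_sum (fun j =>
    iter j (sharp_raise phi \o sharp_raise (pc_B C)) (sharp_raise phi x)).
  exact: (sharp_sum_geometric phi (pc_B C)).
by congr sharp_sum; apply: funext => j; elim: j => //= j ->.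
Qed.

Lemma sharp_phiB_inj x : x = sharp_raise phi (sharp_raise (pc_B C) x) -> x = 0.
Proof.
move=> xE; apply: csharpP => q; elim: q => [|q IHq]; rewrite xE //=.
- by rewrite IHq !linear0.
- exact: linear0.
- by rewrite IHq !linear0.
Qed.

Lemma sharp_perturbation :
  [/\ forall y, g_sharp g phi (sharp_d y) = sharp_d (g_sharp g phi y),
      forall y, f_sharp f (g_sharp g phi y) = y,
      forall x, g_sharp g phi (f_sharp f x) =
        x + (sharp_d (phi_sharp phi x) + phi_sharp phi (sharp_d x))
    & [/\ forall x, f_sharp f (phi_sharp phi x) = 0,
          forall y, phi_sharp phi (g_sharp g phi y) = 0
        & forall x, phi_sharp phi (phi_sharp phi x) = 0]].
Proof.
have [f_phi phi_g phi_phi] := phi_special.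
apply: (@special_perturbation _ _ _
  (sharp_lower (pc_b C)) (sharp_raise (pc_B C)) (sharp_raise phi)
  (sharp_lower (pc_b D)) (sharp_raise (pc_B D)) (sharp_map f) (sharp_map g)).
- exact: sharp_phiB_inj.
- exact: sharp_gE.
- exact: sharp_phiE.
- by move=> y; apply: csharpP => q; exact: fg.
- by move=> x; rewrite sharp_anticomm; apply: csharpP => q; exact: gf.
- by move=> x; apply: csharpP => q; exact: f_b.
- by move=> x; rewrite /= (sharp_map_raise (A' := f) (U := pc_B D)).
- by move=> x; apply: csharpP => -[|q]; try exact: f_phi; exact: linear0.
- by move=> x; apply: csharpP => -[|q] //; exact: phi_g.
- exact: sharp_raise_raise.
- by move=> x; apply: csharpP => q; exact: pc_bb.
- exact: (sharp_raise_raise (@pc_BB _ C)).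
- move=> x; rewrite !sharp_anticomm.
  rewrite [RHS](sharp_map_raise
    (A' := anticomm (pc_b C) (pc_B C)) (U := phi)) //.
  by move=> n z; rewrite (anticomm_phi phi_T).
Qed.

Lemma sharp_raise_T (up : forall m, {linear C m -> C m.+1}) :
  (forall m x, up m (pc_T x) = pc_T (up m x)) -> forall y,
  sharp_T (sharp_raise up y) = sharp_raise up (sharp_T y).
Proof. by move=> up_T; apply: sharp_map_raise => m x; rewrite up_T. Qed.

Lemma sharp_T_additive : {morph @sharp_T k C : x y / x + y}.
Proof. by move=> x y; apply: csharpP => q; exact: linearD. Qed.

Lemma sharp_g_T y :
  g_sharp g phi (sharp_T y) = sharp_T (g_sharp g phi y).
Proof.
apply: (perturbed_g_equivariant
  (delta := sharp_raise (pc_B C)) (phi := sharp_raise phi)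
  sharp_phiB_inj sharp_gE) => [x z|x|x|x].
- exact: sharp_T_additive.
- by apply: sharp_raise_T => m z; rewrite pc_T_B.
- exact: sharp_raise_T.
- by apply: csharpP => q; exact/esym/g_T.
Qed.

Lemma sharp_phi_T x :
  phi_sharp phi (sharp_T x) = sharp_T (phi_sharp phi x).
Proof.
apply: (perturbed_phi_equivariant
  (delta := sharp_raise (pc_B C)) (phi := sharp_raise phi)
  sharp_phiB_inj sharp_phiE) => [{}x z|{}x|{}x].
- exact: sharp_T_additive.
- by apply: sharp_raise_T => m z; rewrite pc_T_B.
- exact: sharp_raise_T.
Qed.

(** A solution z of z = a + phi B z has the parity of a, as phi B is even. *)
Lemma sharp_geometric_parity (z a : csharp C) :
  z = a + sharp_raise phi (sharp_raise (pc_B C) z) ->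
  (a.1 = 0 -> z.1 = 0) /\ (a.2 = 0 -> z.2 = 0).
Proof.
move=> zE; split=> a0; apply: functional_extensionality_dep => q.
  elim: q => [|q IHq]; rewrite zE.
    by rewrite -[LHS]/(a.1 0%N + 0) a0 addr0.
  by rewrite -[LHS]/(a.1 q.+1 + phi _ (pc_B C _ (z.1 q))) IHq a0 !linear0 addr0.
elim: q => [|q IHq]; rewrite zE.
  by rewrite -[LHS]/(a.2 0%N + phi _ 0) a0 linear0 addr0.
by rewrite -[LHS]/(a.2 q.+1 + phi _ (pc_B C _ (z.2 q))) IHq a0 !linear0 addr0.
Qed.

Lemma sharp_retract :
  T_deformation_retract (f_sharp f) (g_sharp g phi) (phi_sharp phi).
Proof.
have [gd fgc gfc _] := sharp_perturbation.
split=> //.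
- split.
  + exact: sharp_map_linear.
  + by split=> x; apply: functional_extensionality_dep => q; exact: linear0.
  + move=> x; rewrite /sharp_d /f_sharp linearD /=.
    rewrite (sharp_map_raise (A' := f) (U := pc_B D)) //.
    by congr (_ + _); apply: csharpP => q; exact: f_b.
  + by move=> x; apply: csharpP => q; exact: f_T.
- split=> //; last exact: sharp_g_T.
  + exact: (perturbed_g_linear (delta := sharp_raise (pc_B C))
      (phi := sharp_raise phi) sharp_phiB_inj sharp_gE).
  + split=> x.
      apply: (sharp_geometric_parity (sharp_gE _)).2.
      by apply: functional_extensionality_dep => q; exact: linear0.
    apply: (sharp_geometric_parity (sharp_gE _)).1.
    by apply: functional_extensionality_dep => q; exact: linear0.
- split=> //; last exact: sharp_phi_T.
  + exact: (perturbed_phi_linear (delta := sharp_raise (pc_B C))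
      (phi := sharp_raise phi) sharp_phiB_inj sharp_phiE).
  + split=> x.
      apply: (sharp_geometric_parity (sharp_phiE _)).1.
      by apply: functional_extensionality_dep => -[|q] //; exact: linear0.
    apply: (sharp_geometric_parity (sharp_phiE _)).2.
    by apply: functional_extensionality_dep => q; exact: linear0.
Qed.

End PerturbedMaps.

(** * The deformation retracts *)

Theorem lemma7p14 (k : pzRingType) (C D : parachain k)
    (f : forall m, {linear C m -> D m}) (g : forall m, {linear D m -> C m})
    (phi : forall m, {linear C m -> C m.+1})
    (f_b : forall m x, f m (pc_b C m x) = pc_b D m (f m.+1 x))
    (g_b : forall m y, g m (pc_b D m y) = pc_b C m (g m.+1 y))
    (fg : forall m y, f m (g m y) = y)
    (gf : forall m x, g m (f m x) = x + anticomm (pc_b C) phi x)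
    (f_B : forall m x, f m.+1 (pc_B C m x) = pc_B D m (f m x))
    (g_T : forall m y, g m (pc_T y) = pc_T (g m y))
    (phi_T : forall m x, phi m (pc_T x) = pc_T (phi m x))
    (phi_special : special f g phi) :
  [/\ (* (i) *)
      S_map (g_nat g phi) /\ coextension g (g_nat g phi),
      (* (ii) *)
      [/\ forall m y, f_nat f (g_nat g phi y) = y :> cnat D m,
          forall m x, g_nat g phi (f_nat f x) =
            x + anticomm (@nat_d k C) (phi_nat phi) x :> cnat C m,
          S_deformation_retract (f_nat f) (g_nat g phi) (phi_nat phi)
        & T_deformation_retract (f_sharp f) (g_sharp g phi) (phi_sharp phi)]
    & (* (iii) *)
      special (f_nat f) (g_nat g phi) (phi_nat phi)].
Proof.
have [gS gE fgS sp] := nat_perturbation f_b fg gf f_B g_T phi_T phi_special.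
split=> //; split=> //; try by case: fgS.
exact: sharp_retract f_b fg gf f_B g_T phi_T phi_special.
Qed.
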